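(* Let $X$ be a Banach space with a biorthogonal system $\{x_i\}_{i=1}^{\infty}\subset X$, $\{f_i\}_{i=1}^{\infty}\subset X^{*}$ bounded by $C$. Then there exists a bounded convex-valued multifunction $F:[0,1]\to 2^{X}\setminus\{\varnothing\}$ with $I(F)=\varnothing$.
   Context: A biorthogonal system bounded by $C$ in a Banach space $X$ is a pair of sequences $\{x_i\}_{i=1}^\infty\subset X$, $\{f_i\}_{i=1}^\infty\subset X^*$ with $f_i(x_j)=\delta_i^j$ (Kronecker delta) and $\|x_i\|\,\|f_i\|\le C$ for all $i,j$. For subsets $A,B$ of a Banach space $X$ and $\lambda\in\mathbb{R}$: $A+B=\{a+b: a\in A, b\in B\}$, $\lambda A=\{\lambda a: a\in A\}$. A tagged partition $(\Gamma,T)$ of $[0,1]$ consists of a partition $\Gamma=\{\Delta_i\}_{i=1}^n$ of $[0,1]$ into (non-overlapping closed) segments $\Delta_i=[a_i,b_i]$ and tags $T=\{\xi_i\}_{i=1}^n$, $\xi_i\in\Delta_i$. Write $|\Delta_i|=b_i-a_i$ and $d(\Gamma)=\max_i|\Delta_i|$. A multifunction is a map $F:[0,1]\to 2^X\setminus\{\varnothing\}$. It is bounded if $M(F)=\sup\{\|a\|: a\in F(t), t\in[0,1]\}<\infty$, and convex-valued if $F(t)$ is convex for every $t$. Its Riemann sums are $S(F,\Gamma,T)=\sum_{i=1}^n|\Delta_i|F(\xi_i)$ (Minkowski sum). The Hausdorff distance between non-empty sets is $d_H(A,B)=\max\{\sup_{a\in A}d(a,B),\sup_{b\in B}d(b,A)\}$.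 For bounded $F$, $I(F)$ is the collection of all non-empty closed subsets $A\subset X$ for which there is a sequence of tagged partitions $(\Gamma_k,T_k)$ with $d(\Gamma_k)\to0$ and $d_H(S(F,\Gamma_k,T_k),A)\to0$ as $k\to\infty$. *)

(* Defs.v *)
From mathcomp Require Export all_boot all_order all_algebra.
From mathcomp Require Export all_classical all_reals all_analysis.
Export Order.TTheory GRing.Theory Num.Theory.
Export numFieldNormedType.Exports.

Set Implicit Arguments.
Unset Strict Implicit.
Unset Printing Implicit Defensive.

Local Open Scope classical_set_scope.
Local Open Scope ring_scope.

Section Biorthogonal.
Context {R : realType} {X : normedModType R}.

(* Finite whenever [f] is continuous; [\bar R] avoids the junk value of the
   real [sup] on unbounded sets. *)
Definition dual_norm (f : {linear X -> R^o}) : \bar R :=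
  ereal_sup [set `|f x|%:E | x in [set x : X | `|x| <= 1]].

Definition biorthogonal_system (x : nat -> X) (f : nat -> {linear X -> R^o})
    (C : R) : Prop :=
  [/\ forall i, continuous (f i),
      forall i j, f i (x j) = (i == j)%:R
    & forall i, (`|x i|%:E * dual_norm (f i) <= C%:E)%E].

End Biorthogonal.

Section MinkowskiHausdorff.
Context {R : realType} {X : normedModType R}.
Implicit Types A B : set X.

Definition minkowski_add A B : set X := [set a + b | a in A & b in B].

Definition minkowski_scale (l : R) A : set X := [set l *: a | a in A].

(* [edist_inf B a] is the distance d(a, B); the Hausdorff distance is [+oo]
   when one of the suprema is infinite. *)
Definition hausdorff_dist A B : \bar R :=
  maxe (ereal_sup [set edist_inf B a | a in A])
       (ereal_sup [set edist_inf A b | b in B]).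

End MinkowskiHausdorff.

(* The segments are listed from left to right: with [tp_pts = [:: t1; ...; tn]],
   [0 < t1 < ... < tn = 1], they are [0, t1], [t1, t2], ..., [t(n-1), tn]. *)
Record tagged_partition (R : realType) := TaggedPartition {
  tp_pts : seq R;
  tp_tag : 'I_(size tp_pts) -> R;
  tp_itv : itv_partition 0 1 tp_pts;
  tp_tagP : forall i : 'I_(size tp_pts),
    tp_tag i \in `[nth 0 (0 :: tp_pts) i, nth 0 tp_pts i]
}.

Section RiemannSums.
Context {R : realType}.

Definition tp_len (P : tagged_partition R) (i : 'I_(size (tp_pts P))) : R :=
  nth 0 (tp_pts P) i - nth 0 (0 :: tp_pts P) i.

(* The lengths are positive, so starting the maximum at 0 is harmless. *)
Definition mesh (P : tagged_partition R) : R :=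
  \big[Num.max/0]_(i < size (tp_pts P)) tp_len i.

Context {X : normedModType R}.

(* A multifunction on [0, 1] is a function [R -> set X] of which only the
   values on [0, 1] matter. *)
Definition nonempty_valued (F : R -> set X) : Prop :=
  forall t : R, t \in `[0, 1] -> F t !=set0.

Definition multifun_sup (F : R -> set X) : \bar R :=
  ereal_sup [set `|a|%:E | a in \bigcup_(t in `[0, 1]) F t].

Definition bounded_multifun (F : R -> set X) : Prop :=
  (multifun_sup F < +oo)%E.

Definition convex_valued (F : R -> set X) : Prop :=
  forall t : R, t \in `[0, 1] -> convex_set (F t : set (convex_lmodType X)).

Definition riemann_sum (F : R -> set X) (P : tagged_partition R) : set X :=
  \big[minkowski_add/[set 0]]_(i < size (tp_pts P))
    minkowski_scale (tp_len i) (F (tp_tag i)).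

Definition riemann_limits (F : R -> set X) : set (set X) :=
  [set A | [/\ A !=set0, closed A
    & exists P : nat -> tagged_partition R,
        mesh (P k) @[k --> \oo] --> 0 /\
        hausdorff_dist (riemann_sum F (P k)) A @[k --> \oo] --> 0%E]].

End RiemannSums.

(* Main.v *)
(* Let U_j enumerate the finite unions of cells of uniform grids, and let F(t)
   be the set of all a in the unit ball with ||x_j|| f_j(a) <= 1_{U_j}(t) for
   every j; it contains x_j / ||x_j|| whenever t is in U_j. Given Riemann sums
   S_k with mesh tending to 0, fix k and choose j so that U_j contains the tags
   of the k-th partition but has measure less than 1/4. Then x_j / ||x_j||
   belongs to S_k, whereas ||x_j|| f_j, of norm at most C, is bounded on S_l by
   the total length of the segments tagged in U_j, which is less than 1/2 for
   large l. Hence (S_k) is not Cauchy for the Hausdorff distance. *)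

Require Import Defs.
From mathcomp Require Import ring lra.

Set Implicit Arguments.
Unset Strict Implicit.
Unset Printing Implicit Defensive.

Local Open Scope classical_set_scope.
Local Open Scope ring_scope.

Section TaggedPartition.
Context {R : realType} (P : tagged_partition R).
Implicit Types i : 'I_(size (tp_pts P)).

(** With [g] the identity this gives total length 1; with [g] a clamping map it bounds the length
    lying inside an interval. *)
Lemma tp_telescope (g : R -> R) :
  \sum_(i < size (tp_pts P))
    (g (nth 0 (tp_pts P) i) - g (nth 0 (0 :: tp_pts P) i))
  = g 1 - g 0.
Proof.
rewrite -(big_mkord xpredT (fun k =>
  g (nth 0 (0 :: tp_pts P) k.+1) - g (nth 0 (0 :: tp_pts P) k))).
rewrite (telescope_sumr (fun k => g (nth 0 (0 :: tp_pts P) k)))//.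
have [_ /eqP last1] := tp_itv P.
by rewrite -last_nth last1.
Qed.

Lemma tp_len_ge0 i : 0 <= tp_len i.
Proof.
by have := tp_tagP i; rewrite in_itv/= subr_ge0 => /andP[]; exact: le_trans.
Qed.

Lemma tp_len_le_mesh i : tp_len i <= mesh P.
Proof. by rewrite /mesh; exact: le_bigmax. Qed.

Lemma sum_tp_len : \sum_i @tp_len R P i = 1.
Proof. by rewrite (tp_telescope id) subr0. Qed.

Lemma mesh_ge0 : 0 <= mesh P.
Proof. by rewrite /mesh; exact: bigmax_ge_id. Qed.

(** Nonnegativity lets [Num.truncn] locate the grid cell of a tag. *)
Lemma tp_tag_ge0 i : 0 <= @tp_tag R P i.
Proof.
have := tp_tagP i; rewrite in_itv/= => /andP[+ _]; apply: le_trans.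
rewrite (set_nth_default 1) /=; last by rewrite ltnS ltnW.
by apply: (itv_partition_nth_ge _ (tp_itv P)); rewrite ltnS ltnW.
Qed.

(* Clamping to [a, b] is 1-Lipschitz and nondecreasing, so the segments inside
   [a, b] contribute at most the telescoping sum of the clamped endpoints. *)
Lemma sum_tp_len_sub (a b : R) : a <= b ->
  \sum_i @tp_len R P i *
    ((a <= nth 0 (0 :: tp_pts P) i) && (nth 0 (tp_pts P) i <= b))%:R <= b - a.
Proof.
move=> ab; pose c (t : R) := Num.max a (Num.min b t).
have c_homo s t : s <= t -> c s <= c t.
  by move=> st; rewrite /c; apply: le_max2 => //; apply: le_min2.
apply: (@le_trans _ _ (c 1 - c 0)).
  rewrite -tp_telescope; apply: ler_sum => i _.
  have := tp_len_ge0 i; rewrite /tp_len subr_ge0 => len_ge0.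
  case: andP => [[al rb]|_].
    have cE t : a <= t -> t <= b -> c t = t.
      by move=> at_ tb; rewrite /c min_r// max_r.
    by rewrite mulr1 !cE// ?(le_trans al)// (le_trans _ rb).
  by rewrite mulr0 subr_ge0 c_homo.
apply: lerB.
  by rewrite /c ge_max ab ge_min lexx.
by rewrite /c le_max lexx.
Qed.

(** A segment whose tag lies in a cell of length [1/m] stays inside that cell widened by the mesh on
    both sides. Repeated entries of [s] only weaken the bound. *)
Lemma sum_tp_len_cells (m : nat) (s : seq nat) : (0 < m)%N ->
  \sum_i @tp_len R P i * (Num.truncn (tp_tag i * m%:R) \in s)%:R
    <= (size s)%:R * (m%:R^-1 + 2 * mesh P).
Proof.
move=> m0; have mR0 : 0 < m%:R :> R by rewrite ltr0n.
have cell_le (c : nat) :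
    \sum_i @tp_len R P i * (Num.truncn (tp_tag i * m%:R) == c)%:R
    <= m%:R^-1 + 2 * mesh P.
  pose a := c%:R / m%:R - mesh P; pose b := c.+1%:R / m%:R + mesh P.
  have ba : b - a = m%:R^-1 + 2 * mesh P.
    by rewrite /a /b -natr1 mulrDl; lra.
  rewrite -ba; apply: le_trans (sum_tp_len_sub (a := a) (b := b) _); last first.
    by rewrite -subr_ge0 ba addr_ge0// ?invr_ge0 ?ler0n// mulr_ge0// mesh_ge0.
  apply: ler_sum => i _; apply: ler_wpM2l; first exact: tp_len_ge0.
  rewrite ler_nat; case: eqP => [/eqP|//].
  rewrite truncn_eq; last by rewrite mulr_ge0// tp_tag_ge0.
  rewrite -ler_pdivrMr// -ltr_pdivlMr// => /andP[ct tc].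
  have := tp_tagP i; rewrite in_itv/= => /andP[lt tr].
  have := tp_len_le_mesh i; rewrite /tp_len => lenm.
  suff -> : (a <= nth 0 (0 :: tp_pts P) i) && (nth 0 (tp_pts P) i <= b) by [].
  by rewrite /a /b; apply/andP; split; lra.
elim: s => [|c s IHs].
  by rewrite mul0r big1// => i _; rewrite in_nil mulr0.
rewrite /= -natr1 mulrDl mul1r addrC.
apply: le_trans (lerD (cell_le c) IHs); rewrite -big_split/=.
apply: ler_sum => i _; rewrite -mulrDr.
apply: ler_wpM2l; first exact: tp_len_ge0.
by rewrite in_cons -natrD ler_nat; case: (_ == c); case: (_ \in s).
Qed.

End TaggedPartition.

Section RiemannSum.
Context {R : realType} {X : normedModType R}.
Variables (F : R -> set X) (P : tagged_partition R).

(** The lengths add up to 1, so [y] is the sum of its multiples [tp_len i *: y]. *)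
Lemma riemann_sum_cst (y : X) :
  (forall i, F (@tp_tag R P i) y) -> riemann_sum F P y.
Proof.
move=> Fy; rewrite -[y]scale1r -(sum_tp_len P) scaler_suml /riemann_sum.
elim/big_ind2: _ => // [a A b B Aa Bb|i _].
  by exists a => //; exists b.
by exists y.
Qed.

Lemma riemann_sum_le (g : {linear X -> R^o}) (h : R -> R) :
  (forall t a, F t a -> g a <= h t) ->
  forall s, riemann_sum F P s -> g s <= \sum_i @tp_len R P i * h (tp_tag i).
Proof.
move=> gh; rewrite /riemann_sum.
elim/big_ind2: _ => [s ->|A u B v Au Bv _ [a Aa] [b Bb] <-|i _ _ [a Fa <-]].
- by rewrite linear0.
- by rewrite linearD lerD ?Au ?Bv.
- by rewrite linearZ ler_wpM2l ?tp_len_ge0// gh.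
Qed.

End RiemannSum.

Section HausdorffDist.
Context {R : realType} {X : normedModType R}.
Implicit Types A B : set X.

Lemma hausdorff_distC A B : hausdorff_dist A B = hausdorff_dist B A.
Proof. exact: maxC. Qed.

(** The strict bound passes to the infimum d(a, B); some point of [B] then realises a distance below
    [e], even if the infimum is not attained. *)
Lemma hausdorff_dist_lt A B (e : R) (a : X) :
  (hausdorff_dist A B < e%:E)%E -> A a -> exists2 b, B b & `|a - b| < e.
Proof.
rewrite gt_max => /andP[+ _] Aa.
have /le_lt_trans/[apply] : (edist_inf B a <=
    ereal_sup [set edist_inf B a' | a' in A])%E.
  by apply: ereal_sup_ubound; exists a.
by move=> /ereal_inf_lt[_ [b Bb <-]] /edist_lt_ball; rewrite -ball_normE; exists b.
Qed.

End HausdorffDist.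

(* Membership of [t >= 0] in [U_j], the union of the cells
   [k / m, (k + 1) / m) with [k] in [s], where [j] codes the pair [(m, s)]. *)
Definition in_cells {R : realType} (j : nat) (t : R) : bool :=
  if unpickle j is Some (m, s) then
    Num.truncn (t * (m : nat)%:R) \in (s : seq nat)
  else false.

Definition cell_multifun {R : realType} {X : normedModType R}
    (x : nat -> X) (f : nat -> {linear X -> R^o}) (t : R) : set X :=
  [set a | `|a| <= 1 /\ forall j, `|x j| * f j a <= (in_cells j t)%:R].

Section CellMultifun.
Context {R : realType} {X : normedModType R}.
Variables (x : nat -> X) (f : nat -> {linear X -> R^o}) (C : R).
Local Notation F := (cell_multifun x f).

Lemma cell_multifun_nonempty : nonempty_valued F.
Proof.
move=> t _; exists 0; split; first by rewrite normr0.
by move=> j; rewrite linear0 mulr0.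
Qed.

Lemma cell_multifun_bounded : bounded_multifun F.
Proof.
apply: (@le_lt_trans _ _ 1%:E); last exact: ltry.
by apply: ub_ereal_sup => _ [a [t _ [a1 _]] <-]; rewrite lee_fin.
Qed.

Lemma cell_multifun_convex : convex_valued F.
Proof.
move=> t _ a b l; rewrite !inE => -[a1 Fa] [b1 Fb].
have l0 : 0 <= l%:num by [].
have l1 : 0 <= 1 - l%:num by rewrite subr_ge0.
(* The convex combination in [convex_lmodType X] unfolds to the usual one in [X]. *)
change (F t (l%:num *: (a : X) + (1 - l%:num) *: (b : X))); split.
  rewrite (le_trans (ler_normD _ _))// !normrZ !ger0_norm//.
  by have := ler_wpM2l l0 a1; have := ler_wpM2l l1 b1; lra.
move=> j; rewrite linearD !linearZ /=.
have := ler_wpM2l l0 (Fa j); have := ler_wpM2l l1 (Fb j).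
by rewrite /GRing.scale/=; lra.
Qed.

Hypothesis xfC : biorthogonal_system x f C.

Lemma biorthogonal_norm_gt0 j : 0 < `|x j|.
Proof.
have [_ fx _] := xfC; rewrite normr_gt0; apply/eqP => xj0.
by have := fx j j; rewrite xj0 linear0 eqxx => /esym/eqP; rewrite oner_eq0.
Qed.

Lemma biorthogonal_bound j a : `|x j| * `|f j a| <= C * `|a|.
Proof.
have [_ _ fC] := xfC; have xj0 := biorthogonal_norm_gt0 j.
have [->|a0] := eqVneq a 0; first by rewrite linear0 !normr0 !mulr0.
have na0 : 0 < `|a| by rewrite normr_gt0.
rewrite -ler_pdivrMr// -lee_fin; apply: le_trans (fC j).
rewrite -mulrA EFinM lee_pmul2l//; apply: ereal_sup_ubound.
(* The supremum defining the dual norm is tested at the normalised vector. *)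
exists (`|a|^-1 *: a) => /=.
  by rewrite normrZ normfV normr_id mulVf// gt_eqF.
by rewrite linearZ /= normrM normfV normr_id mulrC.
Qed.

(** By biorthogonality only the constraint of index [j] sees this vector; its left side is exactly
    1, the value allowed on U_j. *)
Lemma cell_multifun_unit j t : in_cells j t -> F t (`|x j|^-1 *: x j).
Proof.
have [_ fx _] := xfC; have xj0 := biorthogonal_norm_gt0 j => jt; split.
  by rewrite normrZ normfV normr_id mulVf// gt_eqF.
move=> i; rewrite linearZ/= fx; case: eqP => [->|_].
  by rewrite jt /GRing.scale/= mulr1 mulfV// gt_eqF.
by rewrite /GRing.scale/= !mulr0.
Qed.

Lemma cell_multifun_limits : riemann_limits F = set0.
Proof.
rewrite -subset0 => A [_ _ [P [mesh0 dist0]]].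
(* Testing the bound at [x 0] gives [1 <= C]. *)
have C0 : 0 < C.
  have [_ fx _] := xfC; have := biorthogonal_bound 0 (x 0%N).
  rewrite fx eqxx normr1 mulr1 -ler_pdivrMr ?biorthogonal_norm_gt0//.
  by rewrite mulfV ?gt_eqF ?biorthogonal_norm_gt0//; apply: lt_le_trans.
(* Two points within [e] of the same point of [A] are told apart by less than [C * (e + e) = 1/2]
   under each [|x j| f j]. *)
pose e := (4 * C)^-1.
have e0 : 0 < e by rewrite invr_gt0 mulr_gt0.
have near_e : \forall k \near \oo,
    (hausdorff_dist (riemann_sum F (P k)) A < e%:E)%E.
  by apply: (dist0 [set u | (u < e%:E)%E]); apply: open_ereal_lt'; rewrite lte_fin.
have [k Sk] := filter_ex near_e.
(* Since [m > 4n], the at most [n] cells containing tags have total length below 1/4. *)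
pose n := size (tp_pts (P k)); pose m := (4 * n).+1.
pose s := [seq Num.truncn (tp_tag i * m%:R) | i <- enum 'I_n].
pose j := pickle (m, s).
have cellsE (t : R) : in_cells j t = (Num.truncn (t * m%:R) \in s).
  by rewrite /in_cells /j pickleK.
have size_s : size s = n by rewrite size_map size_enum_ord.
pose y := `|x j|^-1 *: x j.
have Sky : riemann_sum F (P k) y.
  apply: riemann_sum_cst => i; apply: cell_multifun_unit.
  by rewrite cellsE; apply: map_f; rewrite mem_enum.
have [a Aa ya] := hausdorff_dist_lt Sk Sky.
have n0 : 0 <= n%:R :> R by rewrite ler0n.
(* Widening [n] cells by a mesh below this value adds at most [2n / (8n + 1) <= 1/4]. *)
have d0 : 0 < (8 * n%:R + 1)^-1 :> R by rewrite invr_gt0; lra.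
have near_d : \forall l \near \oo, mesh (P l) < (8 * n%:R + 1)^-1.
  by move/cvgr_lt : mesh0; exact.
have [l [Sl Pl]] := filter_ex (filterI near_e near_d).
rewrite hausdorff_distC in Sl.
have [b Sb ab] := hausdorff_dist_lt Sl Aa.
have yb : `|y - b| < e + e.
  by rewrite -(subrKA a) (le_lt_trans (ler_normD _ _))// ltrD.
have fy : `|x j| * f j y = 1.
  have [_ fx _] := xfC; rewrite linearZ/= fx eqxx /GRing.scale/= mulr1 mulfV//.
  by rewrite gt_eqF// biorthogonal_norm_gt0.
have fyb : `|x j| * f j (y - b) < 2^-1.
  apply: le_lt_trans (_ : C * `|y - b| < _).
    apply: le_trans (biorthogonal_bound j (y - b)).
    by rewrite ler_pM2l ?biorthogonal_norm_gt0// ler_norm.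
  have -> : 2^-1 = C * (e + e) by rewrite /e; field; rewrite gt_eqF.
  by rewrite ltr_pM2l.
have fb : `|x j| * f j b < 2^-1.
  have := @riemann_sum_le _ _ F (P l) (`|x j| \*: f j)
    (fun t => (in_cells j t)%:R) _ b Sb.
  move=> /(_ (fun t a Fa => Fa.2 j)) /le_lt_trans; apply.
  under eq_bigr do rewrite cellsE.
  apply: le_lt_trans (sum_tp_len_cells _ _ _) _ => //.
  rewrite size_s mulrDr.
  have nm : n%:R / m%:R < 4^-1 :> R.
    rewrite ltr_pdivrMr ?ltr0n//.
    have -> : m%:R = 4 * n%:R + 1 :> R by rewrite -natrM natr1.
    lra.
  have : n%:R * (2 * mesh (P l)) <= 4^-1.
    have := ler_wpM2l n0 (ltW Pl).
    have : n%:R * (8 * n%:R + 1)^-1 <= 8^-1 :> R by rewrite ler_pdivrMr; lra.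
    lra.
  lra.
(* The value 1 at [y] would be the sum of the values at [y - b] and at [b], both below 1/2. *)
by move: fyb; rewrite linearB/= mulrBr fy; lra.
Qed.

End CellMultifun.

Theorem theorem4p5 (R : realType) (X : completeNormedModType R)
    (x : nat -> X) (f : nat -> {linear X -> R^o}) (C : R)
    (xfC : biorthogonal_system x f C) :
  exists F : R -> set X,
    [/\ nonempty_valued F, bounded_multifun F, convex_valued F
      & riemann_limits F = set0].
Proof.
exists (cell_multifun x f); split.
- exact: cell_multifun_nonempty.
- exact: cell_multifun_bounded.
- exact: cell_multifun_convex.
- exact: cell_multifun_limits xfC.
Qed.
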